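(* A monotone map of finite posets $f\colon P\to Q$ is a stratification map if and only if for each $p\in P$ the map $$f_p\colon\mathrm{lk}(p,P)\to F+\mathrm{lk}(f(p),Q),$$ defined as the identity on $F:=\mathrm{lk}\bigl(p,f^{-1}(f(p))\bigr)$ and as the restriction of $f$ elsewhere, is a subdivision map.
   Context: All posets are finite; all maps and homeomorphisms of polyhedra are PL. For a poset $P$, $|P|$ denotes the polyhedron given by the geometric realization of the simplicial complex of nonempty chains of $P$; for a subposet $Q\subset P$, $|Q|$ is a subpolyhedron of $|P|$. For $p\in P$ let $\lceil p\rceil=\{q\in P: q\le p\}$, $\partial\lceil p\rceil=\{q\in P: q<p\}$ and $\mathrm{lk}(p,P)=\{q\in P: q>p\}$. For a poset $X$, $CX$ is $X$ with a greatest element adjoined. The prejoin $X+Y$ of posets is the poset on $X\sqcup Y$ retaining the orders of $X$ and $Y$ in which every element of $X$ is less than every element of $Y$. A subposet $Q$ of $P$ is closed if $p\le q\in Q$ implies $p\in Q$. Subdivision map: a monotone map $f\colon P'\to P$ such that for each $p\in P$, $|f^{-1}(\lceil p\rceil)|$ is homeomorphic to $|Cf^{-1}(\partial\lceil p\rceil)|$ by a homeomorphism fixed on $|f^{-1}(\partial\lceil p\rceil)|$. Collared: a closed subposet $Q$ of $P$ is collared in $P$ if for every $q\in Q$, $|\mathrm{lk}(q,P)|$ is homeomorphic to the cone over $|\mathrm{lk}(q,Q)|$ by a homeomorphism keeping $|\mathrm{lk}(q,Q)|$ fixed (the cone over $\emptyset$ being a point). Stratification map: a monotone map $f\colon P\to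 Q$ such that $f^{-1}(\partial\lceil q\rceil)$ is collared in $f^{-1}(\lceil q\rceil)$ for each $q\in Q$. *)

(* Defs.v *)
From HB Require Import structures.
From mathcomp Require Import all_boot all_order all_algebra.
From mathcomp Require Import boolp classical_sets functions reals.

Set Implicit Arguments.
Unset Strict Implicit.
Unset Printing Implicit Defensive.

Import Order.TTheory GRing.Theory Num.Theory.
Local Open Scope ring_scope.

Section PiecewiseLinear.
Variable R : realType.
Implicit Types V W : lmodType R.

Definition conv_hull V (s : seq V) : set V :=
  [set x | exists a : 'I_(size s) -> R,
    [/\ forall i, 0 <= a i, \sum_i a i = 1 & x = \sum_i a i *: s`_i]]%classic.

Definition affine_on V W (A : set V) (h : V -> W) : Prop :=
  exists (g : {linear V -> W}) (c : W), forall x, A x -> h x = g x + c.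

(* A is a finite union of convex polytopes, each given by a finite list of
   points spanning it, on each of which h is affine. Polytopes are closed, so
   this makes h continuous on A; values of h outside A are irrelevant. *)
Definition pl_on V W (A : set V) (h : V -> W) : Prop :=
  exists K : seq (seq V),
    (forall x, A x <-> exists2 s, s \in K & conv_hull s x) /\
    (forall s, s \in K -> affine_on (conv_hull s) h).

Definition pl_homeo V W (A : set V) (B : set W) (h : V -> W) : Prop :=
  pl_on A h /\
  exists k : W -> V,
    [/\ pl_on B k, set_fun A B h, set_fun B A k,
        {in A, cancel h k} & {in B, cancel k h}].

(* The cone with vertex (0, 1) over A x {0}; for empty A it is the vertex. *)
Definition cone V (A : set V) : set (V * R^o)%type :=
  [set u : V * R^o | u = (0, 1) \/
    exists x (t : R), [/\ A x, 0 <= t <= 1 & u = ((1 - t) *: x, t)]]%classic.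

Definition cone_base V (x : V) : (V * R^o)%type := (x, 0).

End PiecewiseLinear.

Definition subposet d (P : finPOrderType d) (A : {set P}) : Type :=
  {x : P | x \in A}.

HB.instance Definition _ d (P : finPOrderType d) (A : {set P}) :=
  SubFinite.on (subposet A).
HB.instance Definition _ d (P : finPOrderType d) (A : {set P}) :=
  [SubChoice_isSubPOrder of subposet A by <: with d].

(* C P, with [None] as the added greatest element. *)
Definition with_top (P : Type) : Type := option P.

Section WithTop.
Variables (d : Order.disp_t) (P : finPOrderType d).

Definition with_top_le (x y : with_top P) : bool :=
  match x, y with
  | _, None => true
  | None, Some _ => false
  | Some a, Some b => (a <= b)%O
  end.

Fact with_top_le_refl : reflexive with_top_le.
Proof. by case=> //= a; apply: lexx. Qed.

Fact with_top_le_anti : antisymmetric with_top_le.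
Proof. by move=> [a|] [b|] //= /le_anti ->. Qed.

Fact with_top_le_trans : transitive with_top_le.
Proof. by move=> [b|] [a|] [c|] //=; apply: le_trans. Qed.

HB.instance Definition _ := Finite.copy (with_top P) (option P).
HB.instance Definition _ := Order.Le_isPOrder.Build d (with_top P)
  with_top_le_refl with_top_le_anti with_top_le_trans.

(* C A, for a subposet A of P, as a subposet of C P. *)
Definition add_top (A : {set P}) : {set with_top P} :=
  (None : with_top P) |: [set (Some x : with_top P) | x in A].

End WithTop.

Definition prejoin (X Y : Type) : Type := (X + Y)%type.

Section Prejoin.
Variables (d d' : Order.disp_t) (X : finPOrderType d) (Y : finPOrderType d').

Definition prejoin_le (u v : prejoin X Y) : bool :=
  match u, v with
  | inl a, inl b => (a <= b)%O
  | inl _, inr _ => true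
  | inr _, inl _ => false
  | inr a, inr b => (a <= b)%O
  end.

Fact prejoin_le_refl : reflexive prejoin_le.
Proof. by case=> a /=; apply: lexx. Qed.

Fact prejoin_le_anti : antisymmetric prejoin_le.
Proof. by move=> [a|a] [b|b] //= /le_anti ->. Qed.

Fact prejoin_le_trans : transitive prejoin_le.
Proof. by move=> [b|b] [a|a] [c|c] //=; apply: le_trans. Qed.

HB.instance Definition _ := Finite.copy (prejoin X Y) (X + Y)%type.
HB.instance Definition _ := Order.Le_isPOrder.Build d (prejoin X Y)
  prejoin_le_refl prejoin_le_anti prejoin_le_trans.

End Prejoin.

Section Posets.
Variables (R : realType) (d : Order.disp_t) (P : finPOrderType d).
Implicit Types (A B : {set P}) (p q : P).

Definition lower_set p : {set P} := [set q | (q <= p)%O].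
Definition strict_lower_set p : {set P} := [set q | (q < p)%O].

(* lk (p, A) for a subposet A of P. *)
Definition link p A : {set P} := [set q in A | (p < q)%O].

Definition closed_in A B : Prop :=
  A \subset B /\ forall x y, x \in B -> y \in A -> (x <= y)%O -> x \in A.

(* |A| in barycentric coordinates, as a subset of R^P: the points whose support
   is a chain of A. *)
Definition realization A : set {ffun P -> R^o} :=
  [set t : {ffun P -> R^o} |
    [/\ forall x, 0 <= t x,
        \sum_x t x = 1,
        forall x, t x != 0 -> x \in A
      & forall x y, t x != 0 -> t y != 0 -> (x >=< y)%O]]%classic.

(* The inclusion of |P| into |C P|: the coordinate at the new element is 0. *)
Definition top_incl (t : {ffun P -> R^o}) : {ffun with_top P -> R^o} :=
  [ffun o : with_top P => (if o is Some x then t x else 0) : R^o].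

Definition collared A B : Prop :=
  closed_in A B /\
  forall q, q \in A ->
    exists h : {ffun P -> R^o} -> ({ffun P -> R^o} * R^o)%type,
      pl_homeo (realization (link q B)) (cone (realization (link q A))) h /\
      forall x, realization (link q A) x -> h x = cone_base x.

End Posets.

Arguments realization R {d P} A : rename.

Section Maps.
Variables (R : realType) (d d' : Order.disp_t).
Variables (P : finPOrderType d) (Q : finPOrderType d').
Implicit Type f : P -> Q.

Definition monotone f : Prop := {homo f : x y / (x <= y)%O}.

Definition subdivision_map f : Prop :=
  monotone f /\
  forall q : Q,
    exists h : {ffun P -> R^o} -> {ffun with_top P -> R^o},
      pl_homeo (realization R (f @^-1: lower_set q))
               (realization R (add_top (f @^-1: strict_lower_set q))) h /\
      forall x, realization R (f @^-1: strict_lower_set q) x ->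
        h x = top_incl x.

Definition stratification_map f : Prop :=
  monotone f /\
  forall q : Q,
    collared R (f @^-1: strict_lower_set q) (f @^-1: lower_set q).

Variables (f : P -> Q) (fmono : monotone f) (p : P).

Definition fiber_link : {set P} := link p (f @^-1: [set f p]).

Fact mem_fiber_link (x : P) :
  x \in link p [set: P] -> f x = f p -> x \in fiber_link.
Proof. by rewrite !inE => /= -> ->; rewrite eqxx. Qed.

Fact mem_image_link (x : P) :
  x \in link p [set: P] -> f x <> f p -> f x \in link (f p) [set: Q].
Proof.
rewrite !inE /= => /ltW /fmono le_f /eqP ne_f.
by rewrite lt_neqAle eq_sym ne_f.
Qed.

Definition link_map (x : subposet (link p [set: P])) :
    prejoin (subposet fiber_link) (subposet (link (f p) [set: Q])) :=
  match f (val x) =P f p with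
  | ReflectT e => inl (exist _ (val x) (mem_fiber_link (valP x) e))
  | ReflectF n => inr (exist _ (f (val x)) (mem_image_link (valP x) n))
  end.

End Maps.

Arguments link_map {d d' P Q f} fmono p x.

(* Main.v *)
Require Import Defs.
From HB Require Import structures.
From mathcomp Require Import all_boot all_order all_algebra.
From mathcomp Require Import boolp classical_sets functions reals.

(** Let [p] in [P].  The subdivision condition for [link_map fmono p] is one
    condition for each element [z] of the prejoin [F + lk(f p, Q)].

    If [z = a] lies in the fiber link [F], the preimage of the lower set of [z]
    is the lower set of [a] in [lk(p, P)], which has the greatest element [a];
    it is therefore isomorphic to the poset [C] of its strict part, and the
    condition holds whatever [f] is ([lower_set_cone]).

    If [z = q] with [f p < q], the preimages of the lower set and of the strict
    lower set of [z] are the links of [p] in [f^-1(lower_set q)] and in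
    [f^-1(strict_lower_set q)] ([image_link_map_lower],
    [image_link_map_strict_lower]).  The subdivision condition compares the
    first with the realization of [C] of the second, the collar condition at
    [p] for [q] compares it with the geometric cone over the second.  These two
    are the same: the realization of [C A] is the cone over [|A|], by a
    linear isomorphism that is the identity on [|A|] ([cone_realization]).  As
    [p] and [q > f p] vary, the conditions obtained are exactly those that say
    that [f] is a stratification map; the strict preimages are closed because
    [f] is monotone.

    What remains is bookkeeping: the conditions live in different coordinate
    spaces (functions on [P], on a subposet of [P], on that subposet with a top
    element added, or a product with the line).  All the changes of coordinates
    are restrictions of linear maps, inverted on the polyhedra concerned by
    other linear maps ([linear_iso]), and such maps carry PL homeomorphisms to
    PL homeomorphisms ([pl_homeo_rel_linear]). *)

Set Implicit Arguments.
Unset Strict Implicit.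
Unset Printing Implicit Defensive.

Import Order.TTheory GRing.Theory Num.Theory.
Local Open Scope ring_scope.

(** * Linear changes of coordinates *)

Section LinearChangeOfCoordinates.
Variable R : realType.
Implicit Types U V W : lmodType R.

(** Coefficients indexed by [nat] survive a change of list of the same length,
    which coefficients indexed by ['I_(size s)] do not. *)
Lemma conv_hull_natP V (s : seq V) (x : V) :
  conv_hull s x <-> exists a : nat -> R,
    [/\ forall i, (i < size s)%N -> 0 <= a i, \sum_(i < size s) a i = 1
      & x = \sum_(i < size s) a i *: s`_i].
Proof.
split=> [[a [a_ge0 a_sum ->]]|[a [a_ge0 a_sum ->]]]; last first.
  by exists (fun i => a i); split=> // i; apply: a_ge0.
exists (fun k => if insub k is Some i then a i else 0); split.
- by move=> i lti; case: insubP => // j _ _; apply: a_ge0.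
- by rewrite -a_sum; apply: eq_bigr => i _; rewrite valK.
- by apply: eq_bigr => i _; rewrite valK.
Qed.

Lemma conv_hull_linear V W (g : {linear V -> W}) (s : seq V) (y : W) :
  conv_hull (map g s) y <-> exists2 x, conv_hull s x & y = g x.
Proof.
have im (a : nat -> R) : \sum_(i < size s) a i *: (map g s)`_i
    = g (\sum_(i < size s) a i *: s`_i).
  rewrite linear_sum; apply: eq_bigr => i _.
  by rewrite (nth_map 0) // linearZ.
split=> [/conv_hull_natP[a]|[x /conv_hull_natP[a [a_ge0 a_sum ->] ->]]].
  rewrite size_map im => -[a_ge0 a_sum ->].
  by eexists; last reflexivity; apply/conv_hull_natP; exists a.
by apply/conv_hull_natP; exists a; rewrite size_map im.
Qed.

(** The linear maps are mutually inverse on [A] and [B] only; the ambient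
    spaces may have different dimensions, as they do for a subposet of [P] and
    [P] itself. *)
Definition linear_iso V W (A : set V) (B : set W)
    (i : {linear V -> W}) (j : {linear W -> V}) : Prop :=
  [/\ set_fun A B i, set_fun B A j,
      forall x, A x -> j (i x) = x & forall y, B y -> i (j y) = y].

Lemma linear_iso_sym V W (A : set V) (B : set W) i j :
  linear_iso A B i j -> linear_iso B A j i.
Proof. by case. Qed.

Lemma linear_iso_trans U V W (A : set U) (B : set V) (C : set W) i j k l :
  linear_iso A B i j -> linear_iso B C k l ->
  linear_iso A C (k \o i) (j \o l).
Proof.
move=> [iAB jBA ij ji] [kBC lCB kl lk].
split=> x Xx /=; first by apply/kBC/iAB.
- by apply/jBA/lCB.
- by rewrite kl ?ij //; apply: iAB.
- by rewrite ji ?lk //; apply: lCB.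
Qed.

Lemma pl_on_comp_linear U V W (A : set V) (A' : set U) (h : V -> W) i j :
  linear_iso A A' i j -> pl_on A h -> pl_on A' (h \o j).
Proof.
move=> [iA jA ij ji] [K [AK hK]]; exists (map (map i) K); split.
  move=> x; split=> [A'x|[_ /mapP[s sK ->] /conv_hull_linear[y sy ->]]].
    have /AK[s sK sj] := jA _ A'x.
    exists (map i s); first exact: map_f.
    by apply/conv_hull_linear; exists (j x); rewrite ?ji.
  by apply: iA; apply/AK; exists s.
move=> _ /mapP[s sK ->]; have [g [c gc]] := hK s sK.
exists (g \o j), c => _ /conv_hull_linear[y sy ->] /=.
by rewrite ij; [apply: gc | apply/AK; exists s].
Qed.

Lemma pl_on_linear_comp U V W (A : set V) (h : V -> W) (g : {linear W -> U}) :
  pl_on A h -> pl_on A (g \o h).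
Proof.
move=> [K [AK hK]]; exists K; split=> // s /hK[k [c kc]].
by exists (g \o k), (g c) => x /kc /= ->; rewrite linearD.
Qed.

(** Here [b] and [b'] stand for the inclusions of the subpolyhedra [C] and [C']
    on which the homeomorphisms are prescribed; the hypothesis on them says that
    the changes of coordinates match the two prescriptions. *)
Lemma pl_homeo_rel_linear (V V' W W' : lmodType R)
    (A C : set V) (A' C' : set V') (B : set W) (B' : set W')
    i j k l (b : V -> W) (b' : V' -> W') :
  linear_iso A A' i j -> linear_iso B B' k l ->
  (forall x, C' x -> C (j x)) -> (forall x, C' x -> k (b (j x)) = b' x) ->
  (exists h, pl_homeo A B h /\ forall x, C x -> h x = b x) ->
  exists h, pl_homeo A' B' h /\ forall x, C' x -> h x = b' x.
Proof.
move=> isoA isoB jC kbj [h [[plh [h' [plh' hB h'A hh' h'h]]] hb]].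
have [iA jA ij ji] := isoA; have [kB lB kl lk] := isoB.
exists (k \o (h \o j)); split; last first.
  by move=> x Cx /=; rewrite hb ?kbj //; apply: jC.
split; first by apply: pl_on_linear_comp; apply: pl_on_comp_linear isoA plh.
exists (i \o (h' \o l)); split.
- by apply: pl_on_linear_comp; apply: pl_on_comp_linear isoB plh'.
- by move=> x Ax; apply/kB/hB/jA.
- by move=> x Bx; apply/iA/h'A/lB.
- move=> x /set_mem Ax /=.
  by rewrite kl ?hh' ?ji ?inE //; [apply: jA|apply/hB/jA].
- move=> x /set_mem Bx /=.
  by rewrite ij ?h'h ?lk ?inE //; [apply: lB|apply/h'A/lB].
Qed.

End LinearChangeOfCoordinates.

(** * The realization as a polyhedron *)

Section Realization.
Variables (R : realType) (d : Order.disp_t) (P : finPOrderType d).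
Implicit Types (A : {set P}) (t : {ffun P -> R^o}).

Definition vertex (x : P) : {ffun P -> R^o} := [ffun y => (x == y)%:R].

Lemma sum_vertexE (S : {set P}) (a : P -> R) (y : P) :
  (\sum_(x in S) a x *: vertex x) y = if y \in S then a y else 0.
Proof.
rewrite sum_ffunE.
under eq_bigr do rewrite !ffunE.
case: ifPn => yS.
  rewrite (bigD1 y) //= eqxx big1 ?addr0 => [|x /andP[_ /negPf->]].
    by rewrite [_ *: _]mulr1.
  by rewrite scaler0.
rewrite big1 // => x xS; case: eqP => [xy|_]; last by rewrite scaler0.
by rewrite -xy xS in yS.
Qed.

(** The vertices are the standard basis vectors, so barycentric coordinates in
    a simplex are the coordinates of the ambient space. *)
Lemma conv_hull_vertexP (S : {set P}) t :
  conv_hull [seq vertex x | x <- enum S] t <->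
  [/\ forall x, 0 <= t x, \sum_x t x = 1 & forall x, t x != 0 -> x \in S].
Proof.
have sumE (V : nmodType) (F : nat -> V) :
    \sum_(i < size (enum S)) F i = \sum_(x in S) F (index x (enum S)).
  rewrite -[RHS]big_enum /= [RHS]big_tnth; apply: eq_bigr => i _.
  by rewrite (tnth_nth (tnth (in_tuple (enum S)) i)) index_uniq ?enum_uniq.
have hullE (a : nat -> R) :
    \sum_(i < size (enum S)) a i *: [seq vertex x | x <- enum S]`_i
    = \sum_(x in S) a (index x (enum S)) *: vertex x.
  rewrite (sumE _ (fun i => a i *: _`_i)); apply: eq_bigr => x xS.
  by rewrite (nth_map x) ?index_mem ?nth_index ?mem_enum.
rewrite conv_hull_natP size_map; split.
  move=> [a [a_ge0 + ->]]; rewrite hullE sumE => a_sum.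
  have ti x := sum_vertexE S (fun x => a (index x (enum S))) x.
  split=> [x||x].
  - rewrite ti; case: ifP => // xS; apply: a_ge0.
    by rewrite index_mem mem_enum.
  - rewrite -a_sum [RHS]big_mkcond; exact: eq_bigr.
  - by rewrite ti; case: ifP => //; rewrite eqxx.
move=> [t_ge0 t_sum t_supp].
have tS x : x \notin S -> t x = 0.
  by move=> xS; apply/eqP; apply: contraNT xS => /t_supp.
(* [nth] needs a default value; [P] is nonempty since the coordinates of [t]
   sum to one. *)
have [x0 _] : exists x0, t x0 != 0.
  apply: contrapT => t0; have := oner_eq0 R.
  rewrite -t_sum big1 ?eqxx // => x _.
  by apply/eqP; apply: contrapT => /negP tx; apply: t0; exists x.
have nthE x : x \in S -> nth x0 (enum S) (index x (enum S)) = x.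
  by move=> xS; rewrite nth_index // mem_enum.
exists (fun i => t (nth x0 (enum S) i)); split=> [i _||].
- exact: t_ge0.
- rewrite (sumE _ (fun i => t (nth x0 (enum S) i))) -t_sum.
  rewrite [RHS](bigID (mem S)) /= [X in _ + X]big1 ?addr0 => [|x /tS //].
  by apply: eq_bigr => x xS; rewrite nthE.
- rewrite (hullE (fun i => t (nth x0 (enum S) i))); apply/ffunP=> y.
  rewrite (sum_vertexE _ (fun x => t _)).
  by case: ifPn => [/nthE->//|/tS].
Qed.

(** The polytopes required by [pl_on] are the simplices spanned by the chains
    of [A]. *)
Lemma realization_linear_pl (W : lmodType R) A
    (g : {linear {ffun P -> R^o} -> W}) : pl_on (realization R A) g.
Proof.
exists [seq [seq vertex x | x <- enum (C : {set P})] | C in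
  [pred C : {set P} | (C \subset A) &&
    [forall x in C, [forall y in C, (x >=< y)%O]]]].
split; last by move=> s _; exists g, 0 => x _; rewrite addr0.
move=> t; split.
  move=> [t_ge0 t_sum tA tch].
  exists [seq vertex x | x <- enum [set x | t x != 0]].
    apply: fintype.image_f; rewrite inE; apply/andP; split.
      by apply/fintype.subsetP=> x; rewrite inE => /tA.
    apply/forall_inP=> x; rewrite inE => tx.
    by apply/forall_inP=> y; rewrite inE => ty; apply: tch.
  by apply/conv_hull_vertexP; split=> // x; rewrite inE.
move=> [_ /fintype.imageP[C /[!inE] /andP[CA Cch] ->]].
move=> /conv_hull_vertexP[t_ge0 t_sum tC].
split=> // [x /tC|x y /tC xC /tC yC]; first exact: (fintype.subsetP CA).
by have /forall_inP/(_ _ xC)/forall_inP/(_ _ yC) := Cch.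
Qed.

End Realization.

Lemma linear_iso_pl_homeo (R : realType) (d d' : Order.disp_t)
    (P : finPOrderType d) (P' : finPOrderType d') (A : {set P}) (B : {set P'})
    (i : {linear _ -> _}) (j : {linear _ -> _}) :
  linear_iso (realization R A) (realization R B) i j ->
  pl_homeo (realization R A) (realization R B) i.
Proof.
move=> [iAB jBA ij ji]; split; first exact: realization_linear_pl.
exists j; split=> // [|x /set_mem/ij //|x /set_mem/ji //].
exact: realization_linear_pl.
Qed.

(** * Relabelling the vertices of a realization *)

Section Relabelling.
Variables (R : realType) (S T : finType) (e : S -> T).

Definition pushforward (t : {ffun S -> R^o}) : {ffun T -> R^o} :=
  [ffun y => \sum_(x | e x == y) t x].

Definition pullback (u : {ffun T -> R^o}) : {ffun S -> R^o} :=
  [ffun x => u (e x)].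

Fact pushforward_is_linear : linear pushforward.
Proof.
move=> a t u; apply/ffunP=> y; rewrite !ffunE scaler_sumr -big_split.
by apply: eq_bigr => x _; rewrite !ffunE.
Qed.

Fact pullback_is_linear : linear pullback.
Proof. by move=> a t u; apply/ffunP=> x; rewrite !ffunE. Qed.

HB.instance Definition _ := GRing.isLinear.Build R _ _ _ pushforward
  pushforward_is_linear.
HB.instance Definition _ := GRing.isLinear.Build R _ _ _ pullback
  pullback_is_linear.

Hypothesis e_inj : injective e.

Lemma pushforward_imageE t x : pushforward t (e x) = t x.
Proof.
rewrite ffunE (big_pred1 x) // => y; exact: inj_eq.
Qed.

Lemma pushforward_supp t y :
  pushforward t y != 0 -> exists2 x, e x = y & t x != 0.
Proof.
move=> ty; case: (pickP (fun x => e x == y)) => [x /eqP xy | ey].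
  by exists x => //; rewrite -pushforward_imageE xy.
by move: ty; rewrite ffunE big_pred0 ?eqxx.
Qed.

Lemma sum_pushforward t : \sum_y pushforward t y = \sum_x t x.
Proof.
under eq_bigr do rewrite ffunE.
by rewrite (exchange_big_dep predT) //=; apply: eq_bigr => x _;
rewrite (big_pred1 (e x)) // => y; exact: eq_sym.
Qed.

Lemma pushforwardK : cancel pushforward pullback.
Proof. by move=> t; apply/ffunP=> x; rewrite ffunE pushforward_imageE. Qed.

Lemma pullbackK (u : {ffun T -> R^o}) :
  (forall y, u y != 0 -> exists x, e x = y) -> pushforward (pullback u) = u.
Proof.
move=> u_supp; apply/ffunP=> y; have [uy|] := eqVneq (u y) 0.
  rewrite uy; apply/eqP; apply: contraT => /pushforward_supp[x xy].
  by rewrite ffunE xy uy eqxx.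
move=> /u_supp[x <-].
by rewrite pushforward_imageE ffunE.
Qed.

End Relabelling.

(** Only comparability matters, not the order, and only on [A]: a realization
    depends only on which subsets are chains.  So [e] may be an injection
    that is not monotone outside [A], as in [lower_set_cone]. *)
Lemma realization_relabel (R : realType) (d d' : Order.disp_t)
    (S : finPOrderType d) (T : finPOrderType d') (e : S -> T) (A : {set S}) :
  injective e -> {in A &, forall x y, (e x >=< e y)%O = (x >=< y)%O} ->
  linear_iso (realization R A) (realization R (e @: A))
    (pushforward e) (pullback e).
Proof.
move=> e_inj e_cmp; have pullK u : realization R (e @: A) u ->
    pushforward e (pullback e u) = u.
  move=> [_ _ uA _]; apply: (pullbackK e_inj) => y /uA /imsetP[x _ ->].
  by exists x.
split=> [t [t_ge0 t_sum tA t_cmp]|u Au|t _|u]; last exact: pullK.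
- split=> [y||y|y z].
  + by rewrite ffunE; apply: sumr_ge0 => x _; apply: t_ge0.
  + by rewrite sum_pushforward.
  + by move=> /(pushforward_supp e_inj)[x <- /tA xA]; rewrite imset_f.
  + move=> /(pushforward_supp e_inj)[x <- tx].
    move=> /(pushforward_supp e_inj)[x' <- tx'].
    by rewrite e_cmp ?tA //; apply: t_cmp.
- have sumE := sum_pushforward e (pullback e u); rewrite pullK // in sumE.
  case: Au => [u_ge0 u_sum uA u_cmp].
  have supp x : pullback e u x != 0 -> x \in A.
    by rewrite ffunE => /uA; rewrite mem_imset.
  split=> [x|||x y ux uy] //; first by rewrite ffunE.
    by rewrite -sumE.
  rewrite -e_cmp; [|exact: supp|exact: supp].
  by apply: u_cmp; [move: ux|move: uy]; rewrite ffunE.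
- exact: pushforwardK.
Qed.

(** * The cone over a realization *)

Section ConeCoordinates.
Variables (R : realType) (d : Order.disp_t) (P : finPOrderType d).

(** The height in the cone becomes the coordinate at the added element. *)
Definition cone_coord (u : {ffun P -> R^o} * R^o) : {ffun with_top P -> R^o} :=
  [ffun o : with_top P => (if o is Some x then u.1 x else u.2) : R^o].

Definition cone_coord_inv (v : {ffun with_top P -> R^o}) :
    {ffun P -> R^o} * R^o :=
  ([ffun x => v (Some x)], v None).

Fact cone_coord_is_linear : linear cone_coord.
Proof. by move=> a u v; apply/ffunP=> -[x|]; rewrite !ffunE. Qed.

Fact cone_coord_inv_is_linear : linear cone_coord_inv.
Proof.
move=> a u v; congr pair; last by rewrite !ffunE.
by apply/ffunP=> x; rewrite !ffunE.
Qed.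

HB.instance Definition _ := GRing.isLinear.Build R _ _ _ cone_coord
  cone_coord_is_linear.
HB.instance Definition _ := GRing.isLinear.Build R _ _ _ cone_coord_inv
  cone_coord_inv_is_linear.

Lemma sum_with_top (F : with_top P -> R) :
  \sum_o F o = F None + \sum_x F (Some x).
Proof.
rewrite (bigD1 (None : with_top P)) //=; congr (_ + _).
rewrite (reindex_omap Some id) /=; last by case.
by apply: eq_bigl => x; rewrite eqxx.
Qed.

Lemma mem_add_top (A : {set P}) (x : P) :
  ((Some x : with_top P) \in add_top A) = (x \in A).
Proof. by rewrite !inE /= mem_imset //; apply: Some_inj. Qed.

Lemma sum_scale (a : R) (t : {ffun P -> R^o}) :
  \sum_x (a *: t) x = a * \sum_x t x.
Proof. by rewrite mulr_sumr; apply: eq_bigr => x _; rewrite ffunE. Qed.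

(** A chain of [C A] is a chain of [A], possibly with the top element added, so
    a point of its realization with coordinate [t < 1] at the top is
    [(1 - t) x] on [A] for a unique [x] in the realization of [A]; with
    [t = 1] it is the vertex of the cone. *)
Lemma cone_realization (A : {set P}) :
  linear_iso (cone (realization R A)) (realization R (add_top A))
    cone_coord cone_coord_inv.
Proof.
split=> [u|v [v_ge0 + vA v_cmp]|[y t] _|v _]; last 2 first.
- by congr pair; [apply/ffunP=> x|]; rewrite !ffunE.
- by apply/ffunP=> -[x|]; rewrite !ffunE.
- move=> [->|[x [t [[x_ge0 x_sum xA x_cmp] /andP[t0 t1] ->]]]].
    split=> [[x|]||[x|]|[x|] [y|]]; rewrite ?ffunE //= ?ffunE ?eqxx //.
    + by rewrite sum_with_top !ffunE /= big1 ?addr0 // => x _; rewrite !ffunE.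
    + by rewrite !inE.
  have supp y : (1 - t) *: x y != 0 -> x y != 0.
    by apply: contraNneq => ->; rewrite scaler0.
  split=> [[y|]||[y|]|[y|] [z|]]; rewrite ?ffunE //= ?ffunE //.
  + by apply: mulr_ge0; rewrite ?subr_ge0.
  + rewrite sum_with_top ffunE /=.
    under eq_bigr do rewrite ffunE /=.
    by rewrite sum_scale x_sum mulr1 addrC subrK.
  + by rewrite mem_add_top => /supp/xA.
  + by rewrite !inE.
  + by move=> /supp xy /supp xz; apply: x_cmp.
rewrite sum_with_top => v_sum.
have sum_ge0 : 0 <= \sum_x v (Some x) by apply: sumr_ge0.
(* At height one the point of the base cannot be recovered by rescaling: this
   is the vertex. *)
have [v1|v_neq1] := eqVneq (v None) 1.
  left; congr pair; rewrite //=; apply/ffunP=> x; rewrite !ffunE.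
  have S0 : \sum_y v (Some y) = 0.
    by apply: (addrI 1); rewrite addr0 -[RHS]v_sum v1.
  by rewrite (psumr_eq0P _ S0).
right; have t1 : 0 < 1 - v None.
  by rewrite subr_gt0 lt_neqAle v_neq1 -v_sum lerDl.
exists ((1 - v None)^-1 *: [ffun x => v (Some x)]), (v None); split.
- have supp x : ((1 - v None)^-1 *: [ffun x => v (Some x)] : {ffun P -> R^o}) x
      != 0 -> v (Some x) != 0.
    by rewrite !ffunE; apply: contraNneq => ->; rewrite scaler0.
  split=> [x||x /supp/vA|x y /supp vx /supp vy].
  + by rewrite !ffunE; apply: mulr_ge0; [rewrite invr_ge0 ltW | exact: v_ge0].
  + rewrite sum_scale -[RHS](mulVf (lt0r_neq0 t1)); congr (_ * _).
    under eq_bigr do rewrite ffunE.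
    by rewrite -v_sum addrAC subrr add0r.
  + by rewrite mem_add_top.
  + exact: v_cmp vx vy.
- by rewrite v_ge0 -v_sum lerDl.
- by congr pair; rewrite scalerA mulfV ?lt0r_neq0 // scale1r.
Qed.

(** The lower set of [a] has the greatest element [a], so sending [a] to the
    added top element identifies it with [C] of the strict lower set. *)
Lemma lower_set_cone (a : P) :
  exists h : {ffun P -> R^o} -> {ffun with_top P -> R^o},
    pl_homeo (realization R (lower_set a))
             (realization R (add_top (strict_lower_set a))) h /\
    forall x, realization R (strict_lower_set a) x -> h x = top_incl x.
Proof.
pose e (x : P) : with_top P := if x == a then None else Some x.
have e_inj : injective e.
  move=> x y; rewrite /e; case: eqP => [->|_]; case: eqP => [->|_] //.
  by case.
have e_lower : e @: lower_set a = add_top (strict_lower_set a).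
  apply/setP=> -[y|]; rewrite ?mem_add_top.
    apply/imsetP/idP => [[x]|]; rewrite ?inE /e.
      by case: eqP => // /eqP xa; rewrite le_eqVlt (negPf xa) => /= xa' [->].
    move=> ya; exists y; first by rewrite inE ltW.
    by rewrite lt_eqF.
  rewrite !inE; apply/imsetP; exists a; first by rewrite inE.
  by rewrite /e eqxx.
exists (pushforward e); split.
  rewrite -e_lower; apply: linear_iso_pl_homeo.
  apply: realization_relabel => // x y; rewrite !inE /e => xa ya.
  have [-> | _] := eqVneq x a; have [-> | _] := eqVneq y a => //.
  - by rewrite !comparablexx.
  - by rewrite (ge_comparable ya) /=.
  - by rewrite (le_comparable xa) /=.
move=> t [_ _ tA _].
have ta : t a = 0 by apply/eqP; apply: contraT => /tA; rewrite inE ltxx.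
apply/ffunP=> o; rewrite [RHS]ffunE; case: o => [y|]; last first.
  have <- : e a = None by rewrite /e eqxx.
  by rewrite (pushforward_imageE e_inj) ta.
have [->|ya] := eqVneq y a; last first.
  have <- : e y = Some y by rewrite /e (negPf ya).
  exact: pushforward_imageE.
rewrite ta; apply/eqP; apply: contraT => /(pushforward_supp e_inj)[x + tx].
by rewrite /e; case: eqP => // _ [xa]; rewrite xa ta eqxx in tx.
Qed.

End ConeCoordinates.

(** * Realizations of subposets *)

Section SubposetRealization.
Variables (R : realType) (d : Order.disp_t) (P : finPOrderType d).
Variables (L : {set P}).

Lemma realization_subposet (X : {set subposet L}) :
  linear_iso (realization R X) (realization R (val @: X))
    (pushforward val) (pullback val).
Proof. by apply: realization_relabel => //; apply: val_inj. Qed.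

Definition top_map (o : with_top (subposet L)) : with_top P := omap val o.

Lemma top_map_inj : injective top_map.
Proof. by move=> [x|] [y|] //= [] /val_inj ->. Qed.

Lemma realization_top_subposet (X : {set subposet L}) :
  linear_iso (realization R (add_top X)) (realization R (add_top (val @: X)))
    (pushforward top_map) (pullback top_map).
Proof.
have <- : top_map @: add_top X = add_top (val @: X).
  rewrite /add_top imsetU1 -!imset_comp; congr (_ |: _).
by apply: realization_relabel; [exact: top_map_inj | move=> [x|] [y|]].
Qed.

(** The condition of a collar, with coordinates in [P] and the geometric cone,
    against the condition of a subdivision map, with coordinates in [L] and the
    poset [C Y]. *)
Lemma cone_pair_subposet (X Y : {set subposet L}) :
  (exists h, pl_homeo (realization R (val @: X))
      (cone (realization R (val @: Y))) h /\
    forall t, realization R (val @: Y) t -> h t = cone_base t) <->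
  (exists h, pl_homeo (realization R X) (realization R (add_top Y)) h /\
    forall t, realization R Y t -> h t = top_incl t).
Proof.
have isoX := realization_subposet X.
have isoY := linear_iso_trans (cone_realization R (val @: Y))
  (linear_iso_sym (realization_top_subposet Y)).
have [inY outY pushK pullK] := realization_subposet Y.
split.
  apply: (pl_homeo_rel_linear (linear_iso_sym isoX) isoY) => t Yt.
    exact: inY.
  apply/ffunP=> o; rewrite !ffunE; case: o => [x|//] /=.
  by rewrite pushforward_imageE //; apply: val_inj.
apply: (pl_homeo_rel_linear isoX (linear_iso_sym isoY)) => t Yt.
  exact: outY.
have [_ _ coneK _] := isoY.
(* [cone_base t] is the point of the cone over [t] at height zero. *)
rewrite -[RHS]coneK; last first.
  by right; exists t, 0; rewrite lexx ler01 subr0 scale1r.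
congr (cone_coord_inv (pushforward _ _)); apply/ffunP=> o.
by rewrite !ffunE; case: o => [x|//] /=; rewrite ffunE.
Qed.

End SubposetRealization.

(** * Preimages under the map of links *)

Lemma prejoinE (d d' : Order.disp_t) (X : finPOrderType d)
  (Y : finPOrderType d') (u v : prejoin X Y) : (u <= v)%O = prejoin_le u v.
Proof. by []. Qed.

Section LinkMap.
Variables (d d' : Order.disp_t) (P : finPOrderType d) (Q : finPOrderType d').
Variables (f : P -> Q) (fmono : monotone f) (p : P).

Lemma link_map_monotone : monotone (link_map fmono p).
Proof.
move=> x y xy; rewrite prejoinE /link_map.
case: eqP => [fx|fx]; case: eqP => [fy|fy] //=; last exact: fmono.
case: fx; apply/le_anti; rewrite -{1}fy fmono //=; apply: fmono.
by have := valP x; rewrite !inE /= => /ltW.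
Qed.

(** The value [f x] is squeezed between [f p] and [f a], which are equal. *)
Lemma fiber_link_lower (x : subposet (link p [set: P]))
    (a : subposet (fiber_link f p)) : (val x <= val a)%O -> f (val x) = f p.
Proof.
move=> xa; have := valP x; have := valP a.
rewrite !inE /= => /andP[/eqP fa _] px.
by apply/le_anti; rewrite -{1}fa !fmono // ltW.
Qed.

Lemma link_map_le_inl (x : subposet (link p [set: P]))
    (a : subposet (fiber_link f p)) :
  (link_map fmono p x <= inl a :> prejoin _ _)%O = (val x <= val a)%O.
Proof.
rewrite prejoinE /link_map; case: eqP => [//|fx] /=.
by apply/esym/negP => /fiber_link_lower.
Qed.

Lemma link_map_lt_inl (x : subposet (link p [set: P]))
    (a : subposet (fiber_link f p)) :
  (link_map fmono p x < inl a :> prejoin _ _)%O = (val x < val a)%O.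
Proof.
rewrite !lt_leAnge link_map_le_inl.
case: (boolP (val x <= val a)%O) => //= /fiber_link_lower fx.
by rewrite prejoinE /link_map; case: eqP.
Qed.

(** The elements over [f p] go to the lower summand [F], hence below every [q];
    this agrees with comparing their value [f p] with [q]. *)
Lemma link_map_le_inr (x : subposet (link p [set: P]))
    (q : subposet (link (f p) [set: Q])) :
  (link_map fmono p x <= inr q :> prejoin _ _)%O = (f (val x) <= val q)%O.
Proof.
rewrite prejoinE /link_map; case: eqP => [fx|//] /=.
apply/esym; rewrite fx ltW //.
by have := valP q; rewrite !inE.
Qed.

Lemma link_map_lt_inr (x : subposet (link p [set: P]))
    (q : subposet (link (f p) [set: Q])) :
  (link_map fmono p x < inr q :> prejoin _ _)%O = (f (val x) < val q)%O.
Proof.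
rewrite !lt_leAnge link_map_le_inr prejoinE /link_map; case: eqP => [fx|//] /=.
have := valP q; rewrite !inE fx /= => pq.
by rewrite (ltW pq) (lt_geF pq).
Qed.

Lemma image_link_map_lower (q : subposet (link (f p) [set: Q])) :
  val @: (link_map fmono p @^-1: lower_set (inr q : prejoin _ _)) =
  link p (f @^-1: lower_set (val q)).
Proof.
apply/setP=> x; rewrite !inE; apply/imsetP/andP => [[y]|[fx px]].
  rewrite !inE link_map_le_inr => fy ->; split=> //.
  by have := valP y; rewrite !inE.
have xL : x \in link p [set: P] by rewrite !inE.
by exists (Sub x xL); rewrite ?SubK // !inE link_map_le_inr SubK.
Qed.

Lemma image_link_map_strict_lower (q : subposet (link (f p) [set: Q])) :
  val @: (link_map fmono p @^-1: strict_lower_set (inr q : prejoin _ _)) =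
  link p (f @^-1: strict_lower_set (val q)).
Proof.
apply/setP=> x; rewrite !inE; apply/imsetP/andP => [[y]|[fx px]].
  rewrite !inE link_map_lt_inr => fy ->; split=> //.
  by have := valP y; rewrite !inE.
have xL : x \in link p [set: P] by rewrite !inE.
by exists (Sub x xL); rewrite ?SubK // !inE link_map_lt_inr SubK.
Qed.

End LinkMap.

(** * The equivalence *)

Theorem theorem13p1 (R : realType) (d d' : Order.disp_t)
    (P : finPOrderType d) (Q : finPOrderType d') (f : P -> Q)
    (fmono : monotone f) :
  stratification_map R f <->
  (forall p : P, subdivision_map R (link_map fmono p)).
Proof.
split=> [[_ strat] p|subdiv].
  split=> [|[a|q]]; first exact: link_map_monotone.
    have aL : val a \in link p [set: P].
      by have := valP a; rewrite !inE => /andP[].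
    pose a' : subposet (link p [set: P]) := Sub (val a) aL.
    have -> : link_map fmono p @^-1: lower_set (inl a : prejoin _ _) =
        lower_set a'.
      by apply/setP=> x; rewrite !inE link_map_le_inl.
    have -> : link_map fmono p @^-1: strict_lower_set (inl a : prejoin _ _) =
        strict_lower_set a'.
      by apply/setP=> x; rewrite !inE link_map_lt_inl.
    exact: lower_set_cone.
  apply/cone_pair_subposet.
  rewrite image_link_map_lower image_link_map_strict_lower.
  have [_] := strat (val q); apply.
  by have := valP q; rewrite !inE.
split=> // q; split.
  split=> [|x y]; first by apply/fintype.subsetP=> x; rewrite !inE; apply: ltW.
  by rewrite !inE => _ + /fmono => /[swap]; apply: le_lt_trans.
move=> p; rewrite !inE => pq.
have qL : q \in link (f p) [set: Q] by rewrite !inE.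
pose q' : subposet (link (f p) [set: Q]) := Sub q qL.
have [_ /(_ (inr q'))] := subdiv p.
move=> /cone_pair_subposet.
by rewrite image_link_map_lower image_link_map_strict_lower SubK.
Qed.
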